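(* Let $w\in S_n$ be fireworks. If $\alpha\in\mathrm{supp}(\mathfrak{G}_w)$ and $|\alpha|<\deg\mathfrak{G}_w$, then there exists $\beta\in\mathrm{supp}(\mathfrak{G}_w)$ with $\alpha<\beta$ in componentwise order.
   Context: Permutations act on the right; $s_j$ swaps positions $j,j+1$. With $\partial_j f=\frac{f-s_jf}{x_j-x_{j+1}}$ ($s_jf$ swaps $x_j,x_{j+1}$) and $\overline{\partial}_j f=\partial_j((1-x_{j+1})f)$, the Grothendieck polynomial is defined by $\mathfrak{G}_{w_0}=x_1^{n-1}\cdots x_{n-1}$ for $w_0=n(n-1)\cdots1$ and $\mathfrak{G}_w=\overline{\partial}_j\mathfrak{G}_{ws_j}$ when $w(j)<w(j+1)$. $\mathrm{supp}(f)$ is the set of exponent vectors of monomials of $f$ with nonzero coefficient; $|\alpha|=\alpha_1+\cdots+\alpha_n$. Componentwise order: $\alpha\le\beta$ iff $\alpha_i\le\beta_i$ for all $i$, and $\alpha<\beta$ means $\alpha\le\beta$, $\alpha\ne\beta$. A permutation is fireworks if the initial elements of its decreasing runs (maximal consecutive decreasing segments of the one-line notation) occur in increasing order. *)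

(* Defs.v *)
From HB Require Import structures.
From mathcomp Require Import all_boot all_order all_algebra all_fingroup.
From mathcomp Require Import mpoly.
From Stdlib Require Import ClassicalEpsilon.

Set Implicit Arguments.
Unset Strict Implicit.
Unset Printing Implicit Defensive.

Import Order.TTheory GRing.Theory.
Local Open Scope ring_scope.

(* Variables x_1..x_n are 'X_0 .. 'X_(n-1) (0-based indices);
   position j (1-based) of the paper is index j-1 here. *)

Section Groth.
Variable n : nat.

Definition Poly := {mpoly int[n]}.

(* index j+1 as an element of 'I_n (only used when j.+1 < n) *)
Definition nexti (j : 'I_n) : 'I_n := insubd j j.+1.

Definition swapv (j : 'I_n) (f : Poly) : Poly := msym (tperm j (nexti j)) f.

(* divided difference: the (unique, as int[x] is a domain) polynomial q with
   (x_j - x_{j+1}) q = f - s_j f; chosen by classical description. *)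
Definition ddiff (j : 'I_n) (f : Poly) : Poly :=
  epsilon (inhabits 0)
    (fun q : Poly => ('X_j - 'X_(nexti j)) * q = f - swapv j f).

Definition dbar (j : 'I_n) (f : Poly) : Poly := ddiff j ((1 - 'X_(nexti j)) * f).

Definition xdelta : Poly := 'X_[[multinom (n - 1 - i)%N | i < n]].

Definition ascent (w : 'S_n) (j : 'I_n) : bool :=
  (j.+1 < n)%N && (w j < w (nexti j))%N.

(* w s_j in one-line notation: entries at positions j, j+1 swapped,
   i.e. i |-> w (s_j i).  In MathComp (s * t) x = t (s x). *)
Definition rmul_s (w : 'S_n) (j : 'I_n) : 'S_n := (tperm j (nexti j) * w)%g.

(* G_w = dbar_j G_{w s_j} for an ascent j of w; G_{w0} = xdelta.
   The recursion stops at the permutation without ascents, i.e. w0;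
   'C(n,2) steps of fuel always suffice since each step increases the
   number of inversions by one. *)
Fixpoint groth_aux (k : nat) (w : 'S_n) : Poly :=
  match k with
  | 0 => xdelta
  | k'.+1 =>
      match [pick j | ascent w j] with
      | Some j => dbar j (groth_aux k' (rmul_s w j))
      | None => xdelta
      end
  end.

Definition groth (w : 'S_n) : Poly := groth_aux 'C(n, 2) w.

Definition pdeg (f : Poly) : nat := (\max_(m <- msupp f) mdeg m)%N.

Definition mlt (a b : 'X_{1..n}) : bool := (a <= b)%MM && (a != b).

Definition run_start (w : 'S_n) (i : 'I_n) : bool :=
  (val i == 0)%N || (w (insubd i i.-1) < w i)%N.

Definition fireworks (w : 'S_n) : Prop :=
  forall i k : 'I_n, run_start w i -> run_start w k -> (i < k)%N -> (w i < w k)%N.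

End Groth.

(* Main.v *)
Require Import Defs.
From HB Require Import structures.
From mathcomp Require Import all_boot all_order all_algebra all_fingroup.
From mathcomp Require Import mpoly ring zify.
From Stdlib Require Import ClassicalEpsilon.

(* For a position [k] of [w], let [N_k(w)] be the number of positions [p >= k]
   such that some position [q] with [k <= q < p] has [w q > w p], and let
   [N(w)] be the exponent vector with entries [N_k(w)].  For every [w] all
   exponents of [G_w] are componentwise below [N(w)], and for a fireworks [w]
   the vector [N(w)] is itself an exponent; the theorem follows at once.

   Both facts are read off the Fomin-Kirillov formula.  With [n = m + 1] and
   indices starting from [0], [G_w] is the coefficient of [w] in the product of
   the rows [(1 + x_i u_(m-1)) .. (1 + x_i u_i)], for [i = 0, .., m - 1], in the
   0-Hecke algebra ([u_c^2 = -u_c]), here multiplied out from the right, one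
   factor at a time.  While row [i] is
   being processed up to the letter [c], the exponent of [x_i] is controlled by
   the analogue of [N_i] that only sees values [<= c].  Since the coefficients
   alternate in sign with the degree, no cancellation occurs, so exhibiting one
   path to [w] with weight [N(w)] is enough. *)

Set Implicit Arguments.
Unset Strict Implicit.
Unset Printing Implicit Defensive.

Import Order.TTheory GRing.Theory Num.Theory.
Local Open Scope ring_scope.

(** * Adjacent transpositions acting on values and positions *)

Section Simple.
Variable m : nat.
Implicit Types (w : 'S_m.+1) (c d k : nat).

(** In a product the left factor acts first, so [w * simple c] exchanges the values [c] and [c.+1],
    while [simple c * w] exchanges the entries at these positions. *)
Definition simple c : 'S_m.+1 := tperm (inord c) (inord c.+1).

Definition pos w k : 'I_m.+1 := (w^-1)%g (inord k).

Definition ldes w c : bool := (pos w c.+1 < pos w c)%N.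

Definition rdes w c : bool := (w (inord c.+1) < w (inord c))%N.

Lemma eq_inord c d : (c <= m)%N -> (d <= m)%N ->
  ((inord c : 'I_m.+1) == inord d) = (c == d).
Proof. by move=> hc hd; rewrite -val_eqE /= !inordK. Qed.

Lemma simpleE c d : (c < m)%N -> (d <= m)%N ->
  simple c (inord d) =
    inord (if d == c then c.+1 else if d == c.+1 then c else d).
Proof.
move=> hc hd; rewrite /simple; case: tpermP.
- by move/eqP; rewrite eq_inord // 1?ltnW // => /eqP ->; rewrite eqxx.
- move/eqP; rewrite eq_inord // => /eqP ->.
  by rewrite eqxx (_ : (c.+1 == c) = false) //; lia.
move=> /eqP; rewrite eq_inord // 1?ltnW // => /negPf -> /eqP.
by rewrite eq_inord // => /negPf ->.
Qed.

Lemma simpleK c : (simple c * simple c)%g = 1%g.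
Proof. exact: tperm2. Qed.

Lemma mulg_simpleK w c : (w * simple c * simple c)%g = w.
Proof. by rewrite -mulgA simpleK mulg1. Qed.

Lemma pos_mul w c d : (c < m)%N -> (d <= m)%N ->
  pos (w * simple c) d =
    pos w (if d == c then c.+1 else if d == c.+1 then c else d).
Proof. by move=> hc hd; rewrite /pos invMg permM tpermV simpleE. Qed.

Lemma pos_mul_l w c : (c < m)%N -> pos (w * simple c) c = pos w c.+1.
Proof. by move=> hc; rewrite pos_mul ?(ltnW hc) // eqxx. Qed.

Lemma pos_mul_r w c : (c < m)%N -> pos (w * simple c) c.+1 = pos w c.
Proof.
by move=> hc; rewrite pos_mul // eqxx (_ : (c.+1 == c) = false) //; lia.
Qed.

Lemma pos_mul_out w c d : (c < m)%N -> (d <= m)%N -> d != c -> d != c.+1 ->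
  pos (w * simple c) d = pos w d.
Proof. by move=> hc hd /negPf h1 /negPf h2; rewrite pos_mul // h1 h2. Qed.

Lemma simple_far c d : (c.+1 < d)%N -> (d < m)%N ->
  (simple c * simple d)%g = (simple d * simple c)%g.
Proof.
move=> hcd hd; apply/permP => x; rewrite -[x]inord_val; have hx := ltn_ord x.
by rewrite !permM !simpleE; try congr inord; repeat (case: eqP); lia.
Qed.

Lemma simple_braid c : (c.+1 < m)%N ->
  (simple c * simple c.+1 * simple c)%g =
  (simple c.+1 * simple c * simple c.+1)%g.
Proof.
move=> hd; apply/permP => x; rewrite -[x]inord_val; have hx := ltn_ord x.
by rewrite !permM !simpleE; try congr inord; repeat (case: eqP); lia.
Qed.

Lemma pos_inj w c d : (c <= m)%N -> (d <= m)%N ->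
  (pos w c == pos w d :> nat) = (c == d).
Proof. by move=> hc hd; rewrite val_eqE (inj_eq perm_inj) eq_inord. Qed.

End Simple.

(** * The Yang-Baxter relation for two abstract generators *)

Section AbstractHecke.
Variables (R : comNzRingType) (V : lmodType R) (a b : V -> V).
Hypothesis aD : forall f g, a (f + g) = a f + a g.
Hypothesis aZ : forall x f, a (x *: f) = x *: a f.
Hypothesis bD : forall f g, b (f + g) = b f + b g.
Hypothesis bN : forall f, b (- f) = - b f.
Hypothesis bZ : forall x f, b (x *: f) = x *: b f.
Hypothesis aa : forall f, a (a f) = - a f.
Hypothesis bb : forall f, b (b f) = - b f.
Hypothesis aba : forall f, a (b (a f)) = b (a (b f)).
Variable ev : V -> R.
Hypothesis evD : forall f g, ev (f + g) = ev f + ev g.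
Hypothesis evN : forall f, ev (- f) = - ev f.
Hypothesis evZ : forall x f, ev (x *: f) = x * ev f.

(* The Yang-Baxter relation, with the factor [h_b(y - x / (1 - x))] split into
   [h_b(y)] and the denominator-free inverse [(1 - x) - x b] of [h_b(x)]. *)
Lemma abstract_yang_baxter x y f :
  let h u z g := g + z *: u g in
  let k u z g := (1 - z) *: g - z *: u g in
  ev ((1 - x) *: k b y (h a x (h b y (h a y f)))) =
  ev ((1 - y) *: k b x (h a y (h b x (h a x f)))).
Proof.
rewrite /= !(aD, bD, bN, aZ, bZ, aa, bb, aba) !(evD, evN, evZ).
ring.
Qed.
End AbstractHecke.

(** * The 0-Hecke algebra and the commutation of its row products *)

Section Hecke.
Variables (m : nat) (R : idomainType).
Implicit Types (w : 'S_m.+1) (c d i k : nat) (x y : R).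
Notation V := {ffun 'S_m.+1 -> R^o}.
Implicit Types f g : V.

(* The generator [u_c] of the 0-Hecke algebra, acting by left multiplication on
   the coefficient vectors of its elements; [Ur] is right multiplication and
   [H c x], [K c x] are multiplication by [1 + x u_c] and [(1 - x) - x u_c],
   whose product is [1 - x].  The operators are locked because unification
   otherwise unfolds them down to polynomial arithmetic. *)
Fact U_key : unit. Proof. exact: tt. Qed.
Definition U := locked_with U_key (fun c f => [ffun w =>
  if ldes w c then f (w * simple m c)%g - f w else 0] : V).
Fact Ur_key : unit. Proof. exact: tt. Qed.
Definition Ur := locked_with Ur_key (fun c f => [ffun w =>
  if rdes w c then f (simple m c * w)%g - f w else 0] : V).
Definition H c x f : V := f + x *: U c f.

Lemma UE c f w :
  U c f w = if ldes w c then f (w * simple m c)%g - f w else 0.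
Proof. by rewrite /U unlock ffunE. Qed.

Lemma UrE c f w :
  Ur c f w = if rdes w c then f (simple m c * w)%g - f w else 0.
Proof. by rewrite /Ur unlock ffunE. Qed.

Lemma addE f g w : (f + g) w = f w + g w. Proof. by rewrite ffunE. Qed.
Lemma oppE f w : (- f) w = - f w. Proof. by rewrite ffunE. Qed.
Lemma scaleE x f w : (x *: f) w = x * f w. Proof. by rewrite ffunE. Qed.

Lemma UD c f g : U c (f + g) = U c f + U c g.
Proof. by apply/ffunP => w; rewrite !(UE, addE, oppE); case: ifP => _; ring. Qed.
Lemma UZ c x f : U c (x *: f) = x *: U c f.
Proof.
by apply/ffunP => w; rewrite !(UE, scaleE); case: ifP => _; ring.
Qed.
Lemma UrD c f g : Ur c (f + g) = Ur c f + Ur c g.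
Proof. by apply/ffunP => w; rewrite !(UrE, addE); case: ifP => _; ring. Qed.
Lemma UrZ c x f : Ur c (x *: f) = x *: Ur c f.
Proof.
by apply/ffunP => w; rewrite !(UrE, scaleE); case: ifP => _; ring.
Qed.

Lemma UU c f : (c < m)%N -> U c (U c f) = - U c f.
Proof.
move=> hc; apply/ffunP => w; rewrite !(UE, addE, oppE) mulg_simpleK.
rewrite /ldes pos_mul_l // pos_mul_r //.
by case: ltngtP => // *; ring.
Qed.

Lemma U_far c d f : (c.+1 < d)%N -> (d < m)%N -> U c (U d f) = U d (U c f).
Proof.
move=> hcd hd; apply/ffunP => w; rewrite !(UE, addE, oppE) /ldes.
rewrite !(@pos_mul_out m _ c); try lia.
rewrite !(@pos_mul_out m _ d); try lia.
rewrite -!mulgA simple_far //.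
by do !case: ifP => //= _; ring.
Qed.

Lemma U_braid c f : (c.+1 < m)%N ->
  U c (U c.+1 (U c f)) = U c.+1 (U c (U c.+1 f)).
Proof.
move=> hc; have hc' : (c < m)%N by lia.
apply/ffunP => w; rewrite !UE /ldes.
have E1 v : pos (v * simple m c) c.+2 = pos v c.+2 by apply: pos_mul_out; lia.
have E2 v : pos (v * simple m c.+1) c = pos v c by apply: pos_mul_out; lia.
rewrite !(E1, E2, pos_mul_l _ hc', pos_mul_r _ hc').
rewrite !(E1, E2, pos_mul_l _ hc, pos_mul_r _ hc).
have -> : (w * simple m c * simple m c.+1 * simple m c =
  w * simple m c.+1 * simple m c * simple m c.+1)%g.
  by rewrite -!mulgA; congr (_ * _)%g; rewrite !mulgA simple_braid.
rewrite !mulg_simpleK.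
(* Only the relative order of the positions of [c], [c.+1], [c.+2] matters now; they are distinct,
   so six orders remain. *)
have := @pos_inj _ w c c.+1; have := @pos_inj _ w c.+1 c.+2.
have := @pos_inj _ w c c.+2.
move: (nat_of_ord (pos w c.+2)).
move: (nat_of_ord (pos w c)) (nat_of_ord (pos w c.+1)).
move=> a b e h1 h2 h3.
have {}h1 : a != e by rewrite h1; lia.
have {}h2 : b != e by rewrite h2; lia.
have {}h3 : a != b by rewrite h3; lia.
case: (ltngtP b a) h3 => // hab _; case: (ltngtP e b) h2 => // heb _;
case: (ltngtP e a) h1 => // hea _; try lia; ring.
Qed.

Lemma HD c x f g : H c x (f + g) = H c x f + H c x g.
Proof. by rewrite /H UD scalerDr addrACA. Qed.
Lemma HZ c x y f : H c x (y *: f) = y *: H c x f.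
Proof. by rewrite /H UZ scalerDr !scalerA mulrC. Qed.

Definition K c x f : V := (1 - x) *: f - x *: U c f.

Lemma UN c f : U c (- f) = - U c f.
Proof. by rewrite -scaleN1r UZ scaleN1r. Qed.

Lemma HK c x f : (c < m)%N -> H c x (K c x f) = (1 - x) *: f.
Proof.
move=> hc; rewrite /H /K !(UD, UN, UZ, UU) //; apply/ffunP => w.
by rewrite !(addE, oppE, scaleE); ring.
Qed.

Lemma KU c x f : (c < m)%N -> K c x (f + U c f) = (1 - x) *: (f + U c f).
Proof. by move=> hc; rewrite /K UD UU // subrr scaler0 subr0. Qed.

Lemma H_comm c x y f : (c < m)%N -> H c x (H c y f) = H c y (H c x f).
Proof.
move=> hc; rewrite /H !(UD, UZ, UU) //; apply/ffunP => w.
by rewrite !(addE, oppE, scaleE); ring.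
Qed.

Lemma yang_baxter c x y f : (c.+1 < m)%N ->
  (1 - x) *: K c.+1 y (H c x (H c.+1 y (H c y f))) =
  (1 - y) *: K c.+1 x (H c y (H c.+1 x (H c x f))).
Proof.
move=> hc; have hc' : (c < m)%N by lia.
apply/ffunP => w.
exact: (abstract_yang_baxter (UD c) (UZ c) (UD c.+1) (UN c.+1)
  (UZ c.+1) (fun g => UU g hc') (fun g => UU g hc) (fun g => U_braid g hc)
  (fun f g => addE f g w) (fun f => oppE f w) (fun x f => scaleE x f w)).
Qed.

Lemma scale_inj x f g : x != 0 -> x *: f = x *: g -> f = g.
Proof.
move=> hx e; apply/ffunP => w; apply: (mulfI hx).
by rewrite -!scaleE e.
Qed.

(* Left multiplication by [(1 + x u_(m-1)) .. (1 + x u_i)]. *)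
Fact A_key : unit. Proof. exact: tt. Qed.
Definition A := locked_with A_key (fun i x f =>
  foldl (fun g c => H c x g) f (iota i (m - i)) : V).

Lemma AE i x f : A i x f = foldl (fun g c => H c x g) f (iota i (m - i)).
Proof. by rewrite /A unlock. Qed.

Lemma A_top x f : A m x f = f.
Proof. by rewrite AE subnn. Qed.

Lemma A_step i x f : (i < m)%N -> A i x f = A i.+1 x (H i x f).
Proof. by move=> hi; rewrite !AE -(subnSK hi). Qed.

Lemma A_commute (T : V -> V) i x x' f :
  (forall d g, (i <= d < m)%N -> T (H d x g) = H d x' (T g)) ->
  T (A i x f) = A i x' (T f).
Proof.
move=> hT; rewrite !AE.
have: all (fun d => i <= d < m)%N (iota i (m - i)).
  by apply/allP => d; rewrite mem_iota; lia.
elim: (iota _ _) f => //= d s IH f /andP [hd hs].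
by rewrite IH // hT.
Qed.

Lemma AZ i x y f : A i x (y *: f) = y *: A i x f.
Proof. by rewrite (@A_commute (fun g => y *: g) i x x) // => *; rewrite HZ. Qed.

Lemma AD i x f g : A i x (f + g) = A i x f + A i x g.
Proof.
rewrite !AE; elim: (iota _ _) f g => //= d s IH f g.
by rewrite HD IH.
Qed.

Lemma AN i x f : A i x (- f) = - A i x f.
Proof. by rewrite -scaleN1r AZ scaleN1r. Qed.

Lemma U_A c i x f : (c.+1 < i)%N -> U c (A i x f) = A i x (U c f).
Proof.
move=> hc; apply: A_commute => d g hd.
by rewrite /H UD UZ U_far //; lia.
Qed.

Lemma H_A c i x y f : (c.+1 < i)%N -> H c y (A i x f) = A i x (H c y f).
Proof. by move=> hc; rewrite /H AD AZ U_A. Qed.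

(** By descending induction on [i]: after scaling by [1 - v], the two rows become rows from [i.+1]
    applied to a short word in the letters [i] and [i.+1]. Yang-Baxter exchanges the parameters in
    that word, the induction hypothesis those of the shorter rows, and the scalars cancel in a
    domain. *)
Lemma A_comm i x y f : (i <= m)%N -> 1 - x != 0 -> 1 - y != 0 ->
  A i x (A i y f) = A i y (A i x f).
Proof.
move=> hi nx ny; move: {2}(m - i)%N (erefl (m - i)%N) => d.
elim: d i f hi => [|d IH] i f hi hd.
  have -> : i = m by lia.
  by rewrite !A_top.
have him : (i < m)%N by lia.
have [hS|hS] := ltnP i.+1 m; last first.
  have e : i.+1 = m by lia.
  by rewrite !(A_step _ _ him) e !A_top H_comm.
have step u v : (1 - v) *: A i u (A i v f) =
    A i.+1 u (A i.+1 v (K i.+1 v (H i u (H i.+1 v (H i v f))))).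
  rewrite (A_step v) // (A_step u) // (A_step v _ hS) H_A //.
  by rewrite -!AZ -(HK _ _ hS) -(A_step v _ hS).
apply: (scale_inj ny); apply: (scale_inj nx).
rewrite [RHS]scalerA [in RHS]mulrC -[RHS]scalerA !step -!AZ yang_baxter //.
by rewrite IH //; lia.
Qed.

Lemma A_step_K i x y f : (i < m)%N ->
  (1 - y) *: A i x (A i.+1 y f) = A i x (A i y (K i y f)).
Proof. by move=> hi; rewrite -!AZ -(HK _ _ hi) -A_step. Qed.

Lemma A_step_sub i x y f : (i < m)%N ->
  (1 - y) *: A i x (A i.+1 y f) =
  (1 - y) *: A i x (A i y f) - y *: A i x (A i y (U i f)).
Proof. by move=> hi; rewrite A_step_K // /K !(AD, AN, AZ). Qed.

(** [U i] kills [f + U i f], so the extra first factor of [A i y] fixes this vector. *)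
Lemma A_step_add i x y f : (i < m)%N -> 1 - y != 0 ->
  A i x (A i.+1 y f) + A i x (A i.+1 y (U i f)) =
  A i x (A i y f) + A i x (A i y (U i f)).
Proof.
by move=> hi hy; apply: (scale_inj hy); rewrite -!AD A_step_K // KU // !AZ.
Qed.

Lemma A_scale_sub i x y z f g h :
  y *: f = y *: g - z *: h ->
  y *: A i x f = y *: A i x g - z *: A i x h.
Proof. by rewrite -!AZ => ->; rewrite AD AN. Qed.

Lemma pos_simple_mul w j c : pos (simple m j * w)%g c = simple m j (pos w c).
Proof. by rewrite /pos invMg permM tpermV. Qed.

Lemma ltn_simple j (a b : 'I_m.+1) : (j < m)%N ->
  ~ (a = inord j /\ b = inord j.+1) -> ~ (a = inord j.+1 /\ b = inord j) ->
  (simple m j a < simple m j b)%N = (a < b)%N.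
Proof.
move=> hj; rewrite -[a]inord_val -[b]inord_val => h1 h2.
have ha := ltn_ord a; have hb := ltn_ord b.
have {}h1 : ~~ (((a : nat) == j) && ((b : nat) == j.+1)).
  by apply/negP => /andP [/eqP e1 /eqP e2]; apply: h1; rewrite e1 e2.
have {}h2 : ~~ (((a : nat) == j.+1) && ((b : nat) == j)).
  by apply/negP => /andP [/eqP e1 /eqP e2]; apply: h2; rewrite e1 e2.
rewrite !simpleE //; try lia.
rewrite !inordK //; try (repeat (case: eqP); lia).
Qed.

Lemma simple_conj w j c :
  (w (inord j) = inord c /\ w (inord j.+1) = inord c.+1) \/
  (w (inord j) = inord c.+1 /\ w (inord j.+1) = inord c) ->
  (simple m j * w)%g = (w * simple m c)%g.
Proof.
move=> h; have : (simple m j ^ w)%g = simple m c.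
  by rewrite /simple tpermJ; case: h => [] [-> ->] //; rewrite tpermC.
by rewrite conjgE => <-; rewrite !mulgA mulgV mul1g.
Qed.

(** The two actions interact only when positions [j], [j.+1] carry the values [c], [c.+1] in some
    order, and then both exchanges give the same permutation. Otherwise neither exchange affects the
    descent test of the other. *)
Lemma Ur_U j c f : (j < m)%N -> (c < m)%N -> Ur j (U c f) = U c (Ur j f).
Proof.
move=> hj hc; apply/ffunP => w.
have cS : ((inord c.+1 : 'I_m.+1) < (inord c : 'I_m.+1))%N = false.
  by rewrite !inordK; lia.
have cS' : ((inord c : 'I_m.+1) < (inord c.+1 : 'I_m.+1))%N.
  by rewrite !inordK; lia.
have jS : ((inord j.+1 : 'I_m.+1) < (inord j : 'I_m.+1))%N = false.
  by rewrite !inordK; lia.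
have jS' : ((inord j : 'I_m.+1) < (inord j.+1 : 'I_m.+1))%N.
  by rewrite !inordK; lia.
have [/andP [/eqP h1 /eqP h2]|n1] :=
  boolP ((w (inord j) == inord c) && (w (inord j.+1) == inord c.+1)).
  have r : rdes w j = false by rewrite /rdes h1 h2 cS.
  have l : ldes w c = false by rewrite /ldes /pos -h1 -h2 !permK jS.
  by rewrite !(UE, UrE) r l.
have [/andP [/eqP h1 /eqP h2]|n2] :=
  boolP ((w (inord j) == inord c.+1) && (w (inord j.+1) == inord c)).
  have e : (simple m j * w = w * simple m c)%g by apply: simple_conj; right.
  have r : rdes w j by rewrite /rdes h1 h2 cS'.
  have l : ldes w c by rewrite /ldes /pos -h1 -h2 !permK jS'.
  have r' : rdes (w * simple m c) j = false.
    by rewrite /rdes !permM h1 h2 /simple tpermL tpermR cS.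
  have l' : ldes (simple m j * w) c = false.
    by rewrite e /ldes pos_mul_l // pos_mul_r // /pos -h1 -h2 !permK jS.
  by rewrite !(UE, UrE) r l r' l' e; ring.
have hl : ldes (simple m j * w) c = ldes w c.
  rewrite /ldes !pos_simple_mul ltn_simple // => -[h1 h2].
    case/negP: n2; rewrite -h1 -h2 /pos !permKV !eqxx //.
  by case/negP: n1; rewrite -h1 -h2 /pos !permKV !eqxx.
have hr : rdes (w * simple m c) j = rdes w j.
  rewrite /rdes !permM ltn_simple // => -[h1 h2].
    by case/negP: n2; rewrite h1 h2 !eqxx.
  by case/negP: n1; rewrite h1 h2 !eqxx.
rewrite !(UE, UrE) hl hr mulgA; case: (ldes w c); case: (rdes w j) => //=; ring.
Qed.

Definition delta : V := [ffun w => (w == 1%g)%:R].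

Lemma Ur_delta j : (j < m)%N -> Ur j delta = U j delta.
Proof.
move=> hj; apply/ffunP => w; rewrite UE UrE !ffunE.
have e1 : (simple m j * w == 1)%g = (w == simple m j).
  by rewrite -(inj_eq (mulgI (simple m j))) mulgA simpleK mul1g mulg1.
have e2 : (w * simple m j == 1)%g = (w == simple m j).
  by rewrite -(inj_eq (mulIg (simple m j))) mulg_simpleK mul1g.
rewrite e1 e2.
have [->|_] := eqVneq w (simple m j).
  rewrite /rdes /ldes /pos /simple tpermV tpermL tpermR !inordK //; try lia.
have [->|_] := eqVneq w 1%g; last by rewrite subrr !if_same.
by rewrite /rdes /ldes /pos invg1 !perm1 !inordK //; try lia; case: ltngtP.
Qed.

End Hecke.

(** * The Fomin-Kirillov product under divided differences *)

Section PipeDreams.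
Variable m : nat.
Notation P := {mpoly int[m.+1]}.
Notation V := {ffun 'S_m.+1 -> P^o}.
Implicit Types (w : 'S_m.+1) (c d i j k : nat) (f g : V).

Definition X k : P := 'X_(inord k).

(* The product of the rows [i, .., m-1] of the Fomin-Kirillov formula. *)
Fact Gr_key : unit. Proof. exact: tt. Qed.
Definition Gr := locked_with Gr_key (fun i =>
  foldr (fun k f => A k (X k) f) (delta m P) (iota i (m - i)) : V).

Lemma GrE i :
  Gr i = foldr (fun k f => A k (X k) f) (delta m P) (iota i (m - i)).
Proof. by rewrite /Gr unlock. Qed.

Lemma Gr_top : Gr m = delta m P.
Proof. by rewrite GrE subnn. Qed.

Lemma Gr_step i : (i < m)%N -> Gr i = A i (X i) (Gr i.+1).
Proof. by move=> hi; rewrite !GrE -(subnSK hi). Qed.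

Lemma subX_neq0 k : 1 - X k != 0.
Proof.
apply/eqP => /(congr1 (meval (fun _ => 0))).
by rewrite mevalB meval1 mevalXU meval0 subr0 => /eqP; rewrite oner_eq0.
Qed.

Lemma subXX_neq0 j k : (j <= m)%N -> (k <= m)%N -> j != k -> X j - X k != 0.
Proof.
move=> hj hk ne.
apply/eqP => /(congr1 (meval (fun l : 'I_m.+1 => (l == inord j)%:R : int))).
rewrite mevalB !mevalXU meval0 eqxx eq_inord // eq_sym (negPf ne) subr0.
by move/eqP; rewrite oner_eq0.
Qed.

Definition swap_coef j f : V := [ffun w => msym (simple m j) (f w)].

Lemma swap_coefE j f w : swap_coef j f w = msym (simple m j) (f w).
Proof. by rewrite /swap_coef ffunE. Qed.

Lemma msym_simpleX j k : (j < m)%N -> (k <= m)%N ->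
  msym (simple m j) (X k) =
    X (if k == j then j.+1 else if k == j.+1 then j else k).
Proof.
move=> hj hk; rewrite /X msymX; congr 'X_[_]; apply/mnmP => l.
rewrite mnmE !mnm1E /simple tpermV -simpleE //.
by rewrite -(inj_eq (@perm_inj _ (simple m j))) /simple tpermK.
Qed.

Lemma msym_simpleX_out j k : (j < m)%N -> (k <= m)%N -> k != j -> k != j.+1 ->
  msym (simple m j) (X k) = X k.
Proof. by move=> hj hk /negPf h1 /negPf h2; rewrite msym_simpleX // h1 h2. Qed.

Lemma swap_coef_U j c f : swap_coef j (U c f) = U c (swap_coef j f).
Proof.
apply/ffunP => w; rewrite !(swap_coefE, UE).
by case: ifP => _; rewrite ?msymB ?msym0.
Qed.

Lemma swap_coef_H j c x f :
  swap_coef j (H c x f) = H c (msym (simple m j) x) (swap_coef j f).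
Proof.
apply/ffunP => w; rewrite /H -swap_coef_U !(swap_coefE, addE, scaleE).
by rewrite msymD msymM.
Qed.

Lemma swap_coef_A j i x f :
  swap_coef j (A i x f) = A i (msym (simple m j) x) (swap_coef j f).
Proof. by apply: A_commute => d g _; rewrite swap_coef_H. Qed.

Lemma Ur_A j i x f : (j < m)%N -> Ur j (A i x f) = A i x (Ur j f).
Proof.
move=> hj; apply: A_commute => d g hd.
by rewrite /H UrD UrZ Ur_U //; lia.
Qed.

(** Rows from [k > j + 1] on involve neither [X j] nor [X j.+1], and all their letters commute with
    the letter [j]. *)
Lemma swap_coef_Gr j k : (j.+1 < k <= m)%N ->
  swap_coef j (Gr k) = Gr k /\ Ur j (Gr k) = U j (Gr k).
Proof.
move=> hk; move: {2}(m - k)%N (erefl (m - k)%N) => d.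
elim: d k hk => [|d IH] k hk hd.
  have -> : k = m by lia.
  rewrite Gr_top Ur_delta; last by lia.
  split => //; apply/ffunP => w; rewrite swap_coefE ffunE.
  by case: eqP; rewrite ?msym1 ?msym0.
have [||e1 e2] := IH k.+1; try lia.
rewrite Gr_step; last by lia.
rewrite swap_coef_A Ur_A; last by lia.
rewrite U_A; last by lia.
by rewrite e1 e2 msym_simpleX_out //; lia.
Qed.

Lemma Gr_succ j : (j < m)%N -> exists f, [/\ swap_coef j f = f, Ur j f = U j f &
  Gr j.+1 = A j.+1 (X j.+1) f].
Proof.
move=> hj; have [hS|hS] := ltnP j.+1 m.
  exists (Gr j.+2); have [|e1 e2] := @swap_coef_Gr j j.+2; first lia.
  by rewrite -Gr_step.
(* The last variable has an empty row, and the unit of the algebra stands for the remaining rows. *)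
have e : j.+1 = m by lia.
exists (delta m P); rewrite e A_top Gr_top Ur_delta //; split => //.
apply/ffunP => w; rewrite swap_coefE ffunE.
by case: eqP; rewrite ?msym1 ?msym0.
Qed.

(* [f] and [g] are [S psi] and [S u_j psi] where [S = A_j(x_j) A_j(x_(j+1))] is
   symmetric, up to the rows above [j]; the point is that
   [(1 - y) A_(j+1)(y) = A_j(y) ((1 - y) - y u_j)]. *)
Lemma Gr_decomposition i j : (i <= j)%N -> (j < m)%N -> exists f g,
  [/\ swap_coef j f = f, swap_coef j g = g,
    (1 - X j.+1) *: Gr i = (1 - X j.+1) *: f - X j.+1 *: g &
    Gr i + Ur j (Gr i) = f + g].
Proof.
move=> hij hj; move: {2}(j - i)%N (erefl (j - i)%N) => d.
elim: d i hij => [|d IH] i hij hd.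
  have -> : i = j by lia.
  have [f [e1 e2 e3]] := Gr_succ hj.
  have hs g : swap_coef j g = g -> swap_coef j (A j (X j) (A j (X j.+1) g)) =
      A j (X j) (A j (X j.+1) g).
    move=> e; rewrite !swap_coef_A e !msym_simpleX ?(ltnW hj) // !eqxx.
    rewrite (_ : (j.+1 == j) = false); last by lia.
    by rewrite A_comm ?subX_neq0 // ltnW.
  exists (A j (X j) (A j (X j.+1) f)), (A j (X j) (A j (X j.+1) (U j f))).
  split.
  - exact: hs.
  - by apply: hs; rewrite swap_coef_U e1.
  - by rewrite Gr_step // e3 A_step_sub.
  - by rewrite Gr_step // !Ur_A // e3 Ur_A // e2 A_step_add ?subX_neq0.
have [||f [g [e1 e2 e3 e4]]] := IH i.+1; try lia.
have him : (i < m)%N by lia.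
exists (A i (X i) f), (A i (X i) g); split.
- by rewrite swap_coef_A e1 msym_simpleX_out //; lia.
- by rewrite swap_coef_A e2 msym_simpleX_out //; lia.
- by rewrite Gr_step //; apply: A_scale_sub.
- by rewrite Gr_step // Ur_A // -!AD e4.
Qed.

(** In [(1 - X j.+1) f - X j.+1 g] with [f] and [g] symmetric, exchanging the two variables changes
    only the explicit [X j.+1], and the difference is [(X j - X j.+1) (f + g)]. *)
Lemma Gr_dbar i j w : (i <= j < m)%N ->
  (1 - X j.+1) * Gr i w - msym (simple m j) ((1 - X j.+1) * Gr i w) =
  (X j - X j.+1) * (Gr i + Ur j (Gr i)) w.
Proof.
move=> /andP [hij hj]; have [f [g [e1 e2 e3 e4]]] := Gr_decomposition hij hj.
rewrite e4 -scaleE e3 !(addE, oppE, scaleE) msymB !msymM msymB msym1.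
rewrite -!swap_coefE e1 e2 msym_simpleX // (_ : (j.+1 == j) = false) ?eqxx; last by lia.
ring.
Qed.

End PipeDreams.

(** * Values, positions and permutations fixing an initial segment *)

Section Values.
Variable m : nat.
Implicit Types (w : 'S_m.+1) (c d i k : nat) (p q : 'I_m.+1).

Lemma val_mul_simple w c p : (c < m)%N ->
  (w * simple m c)%g p =
  (if w p == c :> nat then c.+1 else if w p == c.+1 :> nat then c else w p)
  :> nat.
Proof.
move=> hc; have hp := ltn_ord (w p).
rewrite permM -{1}[w p]inord_val simpleE // inordK.
  by [].
repeat (case: eqP); lia.
Qed.

Lemma val_pos w c : (c <= m)%N -> w (pos w c) = c :> nat.
Proof. by move=> hc; rewrite /pos permKV inordK. Qed.

Lemma pos_val w p : pos w (w p) = p.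
Proof. by rewrite /pos inord_val permK. Qed.

Lemma val_inj_perm w p q : w p = w q :> nat -> p = q.
Proof. by move=> /val_inj /perm_inj. Qed.

Definition fixes w i := forall p, (p < i)%N -> w p = p.

Lemma fixes_mul_simple w c i : (i <= c < m)%N ->
  fixes (w * simple m c) i -> fixes w i.
Proof.
move=> hc h p hp; apply/val_inj.
have := congr1 val (h p hp); rewrite /= val_mul_simple; last by lia.
by repeat (case: eqP); lia.
Qed.

Lemma fixes_leq w i j : (i <= j)%N -> fixes w j -> fixes w i.
Proof. by move=> hij h p hp; apply: h; lia. Qed.

Lemma fixes_pos w i c : fixes w i -> (i <= c <= m)%N -> (i <= pos w c)%N.
Proof.
move=> h hc; rewrite leqNgt; apply/negP => hp.
have := val_pos w (c := c); rewrite (h _ hp); lia.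
Qed.

Lemma fixes_val w i p : fixes w i -> (i <= p)%N -> (i <= w p)%N.
Proof.
move=> h hp; rewrite leqNgt; apply/negP => hw.
have := h _ hw => /perm_inj e; move: hw; rewrite e; lia.
Qed.
End Values.

(** * Coefficients in the course of one row *)

Section Sweep.
Variables (m : nat) (R : idomainType).
Notation V := {ffun 'S_m.+1 -> R^o}.
Implicit Types (w : 'S_m.+1) (c d i k : nat) (f g : V) (x : R).

(* The partial product of [A], stopped before the letter [c]. *)
Definition sweep i c x f : V := foldl (fun g c => H c x g) f (iota i (c - i)).

Lemma sweep_nil i x f : sweep i i x f = f.
Proof. by rewrite /sweep subnn. Qed.

Lemma sweep_step i c x f : (i <= c)%N ->
  sweep i c.+1 x f = H c x (sweep i c x f).
Proof.
move=> hc; rewrite /sweep subSn // -[(c - i).+1]addn1 iotaD foldl_cat /=.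
by rewrite subnKC.
Qed.

Lemma A_sweep i x f : A i x f = sweep i m x f.
Proof. by rewrite AE. Qed.

Lemma HE c x f w : H c x f w =
  if ldes w c then (1 - x) * f w + x * f (w * simple m c)%g else f w.
Proof. by rewrite /H addE scaleE UE; case: ifP => _; ring. Qed.

Lemma H_neq0 c x f w : H c x f w != 0 ->
  f w != 0 \/ f (w * simple m c)%g != 0.
Proof.
rewrite HE; case: ifP => _; last by left.
have [->|] := eqVneq (f w) 0; last by left.
have [->|] := eqVneq (f (w * simple m c)%g) 0; last by right.
by rewrite !mulr0 addr0 eqxx.
Qed.

Lemma sweep_ind (Q : nat -> V -> Prop) i x f :
  Q i f -> (forall c g, (i <= c < m)%N -> Q c g -> Q c.+1 (H c x g)) ->
  forall c, (i <= c <= m)%N -> Q c (sweep i c x f).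
Proof.
move=> h0 hS c; elim: c => [|c IH] hc.
  have e : i = 0%N by lia.
  by move: h0; rewrite e sweep_nil.
have [e|ne] := eqVneq i c.+1; first by rewrite -e sweep_nil.
by rewrite sweep_step; [apply: hS; [|apply: IH]|]; lia.
Qed.

End Sweep.

(** * The coefficient of the longest permutation *)

Section Top.
Variable m : nat.
Notation P := {mpoly int[m.+1]}.
Notation V := {ffun 'S_m.+1 -> P^o}.
Implicit Types (w : 'S_m.+1) (c d i k : nat) (f g : V).

Lemma sweep_fixes i x f :
  (forall w, f w != 0 -> fixes w i) ->
  forall c, (i <= c <= m)%N -> forall w, sweep i c x f w != 0 -> fixes w i.
Proof.
move=> h.
apply: (@sweep_ind _ _ (fun c g => forall w, g w != 0 -> fixes w i)) => //.
move=> c g hc IH w /H_neq0 [/IH //|/IH]; exact: fixes_mul_simple.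
Qed.

Lemma Gr_fixes i w : (i <= m)%N -> Gr m i w != 0 -> fixes w i.
Proof.
move: {2}(m - i)%N (erefl (m - i)%N) => d.
elim: d i w => [|d IH] i w hd hi.
  have -> : i = m by lia.
  rewrite Gr_top ffunE; case: (eqVneq w 1%g) => [-> _ p _|_].
    by rewrite perm1.
  by rewrite eqxx.
rewrite Gr_step ?A_sweep; last by lia.
apply: sweep_fixes; last by lia.
move=> v hv; apply: (@fixes_leq _ _ _ i.+1) => //; apply: IH => //; lia.
Qed.

(** Position [i] holds the value [i] when row [i] begins, and the letter [c] can only raise it from
    [c] to [c.+1]. *)
Lemma sweep_val i : (i < m)%N -> forall c, (i <= c <= m)%N ->
  forall w, sweep i c (X m i) (Gr m i.+1) w != 0 -> (w (inord i) <= c)%N.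
Proof.
move=> hi.
apply: (@sweep_ind _ _ (fun c g => forall w, g w != 0 -> (w (inord i) <= c)%N)).
  by move=> w /Gr_fixes ->; rewrite // inordK //; lia.
move=> c g hc IH w /H_neq0 [/IH|/IH]; first by lia.
by rewrite val_mul_simple; [repeat (case: eqP)|]; lia.
Qed.

Definition decreasing_from w i :=
  forall p q : 'I_m.+1, (i <= p)%N -> (p < q)%N -> (w q < w p)%N.

(** A single path contributes. If position [i] holds [c.+1] after the letter [c], then by
    [sweep_val] it held [c] before, so the letter must have swapped, at the price of one factor
    [X m i]. As [w] has its largest value [m] at position [i], row [i] contributes [m - i]
    factors. *)
Lemma Gr_decreasing i w : (i <= m)%N -> fixes w i -> decreasing_from w i ->
  Gr m i w = \prod_(i <= k < m) X m k ^+ (m - k).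
Proof.
move: {2}(m - i)%N (erefl (m - i)%N) => d.
elim: d i w => [|d IH] i w hd hi hw hdec.
  have e : i = m by lia.
  rewrite e big_geq // Gr_top ffunE (_ : w = 1%g) ?eqxx //.
  apply/permP => p; rewrite perm1; have [hp|hp] := ltnP p i; first exact: hw.
  have := fixes_val hw hp; have := ltn_ord p; have := ltn_ord (w p) => *.
  apply/val_inj => /=; lia.
have him : (i < m)%N by lia.
have hi0 : (inord i : 'I_m.+1) = i :> nat by rewrite inordK //; lia.
rewrite Gr_step // A_sweep big_ltn //.
have main c v : (i <= c <= m)%N -> fixes v i -> decreasing_from v i.+1 ->
    v (inord i) = c :> nat -> sweep i c (X m i) (Gr m i.+1) v =
    X m i ^+ (c - i) * \prod_(i.+1 <= k < m) X m k ^+ (m - k).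
  elim: c v => [|c IHc] v hc hv hdv e.
    have ei : i = 0%N by lia.
    rewrite /sweep sub0n /= expr0 mul1r IH // ?subnS ?hd // => p hp.
    apply/val_inj => /=; rewrite (_ : p = inord i) ?e; first by rewrite hi0 ei.
    by apply/val_inj; rewrite /= hi0; lia.
  have [ec|ec] := eqVneq i c.+1.
    rewrite -ec sweep_nil subnn expr0 mul1r IH // ?subnS ?hd // => p hp.
    have [hp'|hp'] := ltnP p i; first exact: hv.
    have -> : p = inord i by apply/val_inj; rewrite /= hi0; lia.
    by apply/val_inj => /=; rewrite e hi0.
  have hcm : (c < m)%N by lia.
  have pS : pos v c.+1 = inord i by rewrite -e pos_val.
  have pc : (i <= pos v c)%N by apply: fixes_pos => //; lia.
  have ld : ldes v c.
    rewrite /ldes pS hi0 ltn_neqAle pc andbT; apply/eqP => e'.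
    have : v (inord i) = c :> nat.
      rewrite (_ : inord i = pos v c) ?val_pos //; first by lia.
      by apply/val_inj; rewrite /= hi0.
    by rewrite e; lia.
  rewrite sweep_step; last by lia.
  rewrite HE ld (_ : sweep i c _ _ v = 0) ?mulr0 ?add0r; last first.
    apply/eqP; apply/negPn/negP => /(sweep_val him).
    by rewrite e; lia.
  rewrite IHc ?mulrA -?exprS -?subSn //; try lia.
  - move=> p hp; apply/val_inj => /=; rewrite val_mul_simple // hv //.
    by repeat (case: eqP); lia.
  - move=> p q hp hpq; have := hdv p q hp hpq; rewrite !val_mul_simple //.
    have : v p <> c.+1 :> nat.
      move=> e'; have : p = inord i by apply: (@val_inj_perm _ v); rewrite e'.
      by move/(congr1 val) => /=; rewrite hi0; lia.
    by repeat (case: eqP); lia.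
  - by rewrite val_mul_simple // e; repeat (case: eqP); lia.
apply: main => //; first by lia.
  by move=> p q hp; apply: hdec; lia.
have e0 := ltn_ord (w (inord i)).
have [hlt|] := ltnP (w (inord i)) m; last by lia.
have : (i <= pos w m)%N by apply: fixes_pos; rewrite // hi leqnn.
rewrite leq_eqVlt => /orP [/eqP e|hp].
  by rewrite (_ : inord i = pos w m) ?val_pos //; apply/val_inj; rewrite /= hi0.
have := hdec (inord i) (pos w m); rewrite hi0 val_pos //; lia.
Qed.

Lemma prod_xdelta : \prod_(0 <= k < m) X m k ^+ (m - k) = xdelta m.+1.
Proof.
rewrite big_mkord /xdelta mpolyXE_id big_ord_recr mnmE.
rewrite subSS subn0 subnn expr0 /= mulr1.
apply: eq_bigr => i _; rewrite mnmE /X; congr (_ ^+ _).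
congr mpolyX; congr mnm1.
by apply/val_inj; rewrite /= inordK //; have := ltn_ord i; lia.
Qed.
End Top.

(** * Grothendieck polynomials as coefficients of the product *)

Section GrothGr.
Variable m : nat.
Notation P := {mpoly int[m.+1]}.
Implicit Types (w : 'S_m.+1) (j : 'I_m.+1).

Lemma nextiE j : (j < m)%N -> nexti j = inord j.+1.
Proof.
move=> hj; apply/val_inj; rewrite /nexti /= inordK // val_insubd.
by rewrite ltnS hj.
Qed.

Lemma swapvE j (f : P) : (j < m)%N -> swapv j f = msym (simple m j) f.
Proof. by move=> hj; rewrite /swapv nextiE // /simple inord_val. Qed.

(** The quotient is unique because [X m j - X m j.+1] is nonzero in a domain, so [epsilon] can only
    return [q]. *)
Lemma ddiffE j (f q : P) : (j < m)%N ->
  (X m j - X m j.+1) * q = f - msym (simple m j) f -> ddiff j f = q.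
Proof.
move=> hj e; have eX : 'X_j - 'X_(nexti j) = X m j - X m j.+1 :> P.
  by rewrite /X inord_val nextiE.
have nz : X m j - X m j.+1 != 0 by apply: subXX_neq0; lia.
apply: (mulfI nz); rewrite e -swapvE // -eX.
apply: (epsilon_spec (inhabits 0)
  (fun q : P => ('X_j - 'X_(nexti j)) * q = f - swapv j f)).
by exists q; rewrite eX swapvE.
Qed.

(** By [Gr_dbar] the operator yields [Gr + Ur j Gr] at [simple m j * w]; since [j] is a descent
    there, the sum telescopes to the coefficient of [w]. *)
Lemma dbar_Gr w j : ascent w j -> dbar j (Gr m 0 (rmul_s w j)) = Gr m 0 w.
Proof.
case/andP => hj; have {}hj : (j < m)%N by lia.
rewrite nextiE // => ha.
have er : rmul_s w j = (simple m j * w)%g.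
  by rewrite /rmul_s nextiE // /simple inord_val.
rewrite /dbar er; apply: ddiffE => //.
rewrite nextiE // Gr_dbar //; congr (_ * _).
rewrite addE UrE mulgA simpleK mul1g.
have -> : rdes (simple m j * w) j.
  by rewrite /rdes !permM /simple tpermL tpermR inord_val.
by rewrite addrC subrK.
Qed.

(** The number of noninversions measures the distance to the longest permutation, hence the fuel
    required. *)
Definition coinv w :=
  [set p : 'I_m.+1 * 'I_m.+1 | (p.1 < p.2)%N && (w p.1 < w p.2)%N].

Lemma card_coinv w : (#|coinv w| <= 'C(m.+1, 2))%N.
Proof.
pose F (p : 'I_m.+1 * 'I_m.+1) := [tuple p.1; p.2].
have Finj : injective F by move=> [a b] [a' b'] /(congr1 val) [-> ->].
rewrite -card_ltn_sorted_tuples -(card_imset _ Finj).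
apply/subset_leq_card/subsetP => q /imsetP [p hp ->].
move: hp; rewrite [p \in _]inE => /andP [hp _].
by rewrite inE /= hp.
Qed.

(** Applying [simple m j] to both positions embeds the noninversions of the new permutation into
    those of [w], and misses the pair [(j, j+1)]. *)
Lemma coinv_lt w j : ascent w j -> (#|coinv (rmul_s w j)| < #|coinv w|)%N.
Proof.
case/andP => hj; have {}hj : (j < m)%N by lia.
rewrite nextiE // => ha.
have er : rmul_s w j = (simple m j * w)%g.
  by rewrite /rmul_s nextiE // /simple inord_val.
have pS : ((j, inord j.+1) : 'I_m.+1 * 'I_m.+1) \in coinv w.
  by rewrite inE /= ha inordK // ltnS leqnn.
rewrite (cardsD1 (j, inord j.+1) (coinv w)) pS add1n ltnS er.
pose F (p : 'I_m.+1 * 'I_m.+1) := (simple m j p.1, simple m j p.2).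
have Finj : injective F by move=> [a b] [a' b'] [] /perm_inj -> /perm_inj ->.
rewrite -(card_imset _ Finj); apply/subset_leq_card/subsetP => q.
case/imsetP => -[a b]; rewrite inE /= !permM => /andP [hab hw] ->.
have n1 : ~ (a = inord j /\ b = inord j.+1).
  move=> [ea eb]; move: hw; rewrite ea eb /simple tpermL tpermR inord_val.
  by move: ha; lia.
rewrite !inE /= hw andbT ltn_simple ?hab ?andbT //.
  apply/eqP => -[ea eb]; have eb' : b = inord j.
    by apply: (@perm_inj _ (simple m j)); rewrite eb /simple tpermL.
  have ea' : a = inord j.+1.
    by apply: (@perm_inj _ (simple m j)); rewrite ea /simple tpermR inord_val.
  by move: hab; rewrite ea' eb' !inordK //; lia.
by case=> ea eb; move: hab; rewrite ea eb !inordK //; lia.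
Qed.

Lemma no_ascent w : (forall j, ~~ ascent w j) -> Gr m 0 w = xdelta m.+1.
Proof.
move=> h; rewrite Gr_decreasing ?prod_xdelta // => p q _ hpq.
have [d hd] : exists d, (q = p + d.+1 :> nat)%N by exists (q - p).-1; lia.
elim: d q hpq hd => [|d IH] q hpq hd.
  have hqm := ltn_ord q.
  have := h p; rewrite /ascent (_ : (p.+1 < m.+1)%N); last by lia.
  have -> : nexti p = q.
    have hq := ltn_ord q; apply/val_inj; rewrite nextiE /= ?inordK //; lia.
  rewrite /= -leqNgt leq_eqVlt => /orP [/eqP /val_inj_perm e|//].
  by move: hpq; rewrite e ltnn.
have hq := ltn_ord q.
have [q' eq'] : exists q' : 'I_m.+1, q' = q.-1 :> nat.
  by exists (inord q.-1); rewrite inordK //; lia.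
have h1 : (w q' < w p)%N by apply: IH; lia.
apply: ltn_trans h1.
have := h q'; rewrite /ascent (_ : (q'.+1 < m.+1)%N); last by lia.
have -> : nexti q' = q.
  by apply/val_inj; rewrite nextiE /= ?inordK //; lia.
rewrite /= -leqNgt leq_eqVlt => /orP [/eqP /val_inj_perm e|//].
by have := congr1 val e; rewrite /=; lia.
Qed.

(** [dbar_Gr] holds at every ascent, hence at the one that [pick] selects. *)
Lemma groth_auxE k w : (#|coinv w| <= k)%N -> groth_aux k w = Gr m 0 w.
Proof.
elim: k w => [|k IH] w hk /=.
  rewrite no_ascent // => j; apply/negP => /coinv_lt; lia.
case: pickP => [j hj|h]; last by rewrite no_ascent // => j; rewrite h.
by rewrite IH ?dbar_Gr //; have := coinv_lt hj; lia.
Qed.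

Lemma grothE w : groth w = Gr m 0 w.
Proof. exact/groth_auxE/card_coinv. Qed.
End GrothGr.

(** * Entries that are not left-to-right maxima *)

Section NonRecords.
Variable m : nat.
Implicit Types (w : 'S_m.+1) (c d i k : nat) (p q : 'I_m.+1).

(* In the subword of the values [<= c] in positions [>= i], the entries that are
   not left-to-right maxima. *)
Definition nonrec i c w : {set 'I_m.+1} :=
  [set p : 'I_m.+1 | [&& i <= p, w p <= c &
     [exists q : 'I_m.+1, [&& i <= q, q < p, w p < w q & w q <= c]]]%N].

Lemma nonrecP i c w p :
  reflect ([/\ i <= p, w p <= c & exists q : 'I_m.+1,
     [/\ i <= q, q < p, w p < w q & w q <= c]]%N) (p \in nonrec i c w).
Proof.
rewrite inE; apply: (iffP and3P) => -[h1 h2].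
  by move/existsP => [q /and4P h3]; split=> //; exists q.
by case=> q h3; split=> //; apply/existsP; exists q; apply/and4P.
Qed.

Lemma pos_unique w c p : w p = c :> nat -> p = pos w c.
Proof. by move=> <-; rewrite pos_val. Qed.

Lemma nonrec_sub i c w : nonrec i c w \subset nonrec i c.+1 w.
Proof.
apply/subsetP => p /nonrecP [h1 h2 [q [h3 h4 h5 h6]]].
by apply/nonrecP; split=> //; [lia|exists q; split=> //; lia].
Qed.

Lemma pos_notin_nonrec i c w : (c <= m)%N -> pos w c \notin nonrec i c w.
Proof.
by move=> hc; apply/negP => /nonrecP [_ _ [q []]]; rewrite val_pos //; lia.
Qed.

Lemma pos_in_nonrec i c w : (i <= c < m)%N -> fixes w i -> ldes w c ->
  pos w c \in nonrec i c.+1 w.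
Proof.
move=> hc hw hl; have e1 := @val_pos _ w c; have e2 := @val_pos _ w c.+1.
have f1 := @fixes_pos _ w i c hw; have f2 := @fixes_pos _ w i c.+1 hw.
apply/nonrecP; split; try lia.
by exists (pos w c.+1); split=> //; lia.
Qed.

(** Here [c] precedes [c.+1], so it replaces [c.+1] wherever the latter serves as a larger earlier
    entry; [c.+1] itself has no larger competitor. *)
Lemma nonrec_skip i c w : (i <= c < m)%N -> fixes w i -> ~~ ldes w c ->
  nonrec i c.+1 w = nonrec i c w.
Proof.
move=> hc hw hl; apply/eqP; rewrite eqEsubset nonrec_sub andbT.
have e1 := @val_pos _ w c; have e2 := @val_pos _ w c.+1.
have f1 := @fixes_pos _ w i c hw.
apply/subsetP => p /nonrecP [h1 h2 [q [h3 h4 h5 h6]]].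
have hl' : (pos w c <= pos w c.+1)%N by rewrite leqNgt.
have [eq|neq] := eqVneq (w q : nat) c.+1.
  have qe := congr1 val (pos_unique eq); rewrite /= in qe.
  have [ep|nep] := eqVneq (w p : nat) c.
    by have := congr1 val (pos_unique ep) => /=; lia.
  by apply/nonrecP; split; try lia; exists (pos w c); split=> //; lia.
by apply/nonrecP; split; try lia; exists q; split=> //; lia.
Qed.

(** The entry [c] directly follows [c.+1], so it takes over as larger earlier entry for everything
    further right; only [c] itself is new. *)
Lemma nonrec_adjacent i c w : (i <= c < m)%N -> fixes w i ->
  pos w c = (pos w c.+1).+1 :> nat ->
  nonrec i c.+1 w = pos w c |: nonrec i c w.
Proof.
move=> hc hw hl; have e1 := @val_pos _ w c; have e2 := @val_pos _ w c.+1.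
have f1 := @fixes_pos _ w i c hw.
apply/eqP; rewrite eqEsubset subUset sub1set nonrec_sub andbT.
rewrite pos_in_nonrec ?andbT //; last by rewrite /ldes hl.
apply/subsetP => p /nonrecP [h1 h2 [q [h3 h4 h5 h6]]]; rewrite in_setU1.
have [ep|nep] := eqVneq (w p : nat) c; first by rewrite (pos_unique ep) eqxx.
apply/orP; right; apply/nonrecP; split=> //; first by lia.
have [eq|neq] := eqVneq (w q : nat) c.+1; last by exists q; split=> //; lia.
have qe := congr1 val (pos_unique eq); rewrite /= in qe.
exists (pos w c); split=> //; try lia.
have : p != pos w c :> nat by apply: contra nep => /eqP/val_inj ->; apply/eqP; lia.
by lia.
Qed.

(** After the exchange [c] stands where [c.+1] stood and dominates the same entries, while the old
    place of [c] holds [c.+1] and leaves the range. *)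
Lemma nonrec_swap i c w : (i <= c < m)%N -> fixes w i -> ldes w c ->
  nonrec i c.+1 w = pos w c |: nonrec i c (w * simple m c)%g.
Proof.
move=> hc hw hl; have e1 := @val_pos _ w c; have e2 := @val_pos _ w c.+1.
have f1 := @fixes_pos _ w i c hw; have f2 := @fixes_pos _ w i c.+1 hw.
have hcm : (c < m)%N by lia.
apply/eqP; rewrite eqEsubset subUset sub1set pos_in_nonrec //=.
apply/andP; split; apply/subsetP => p /nonrecP [h1 h2 [q [h3 h4 h5 h6]]].
  rewrite in_setU1.
  have [ep|nep] := eqVneq (w p : nat) c; first by rewrite (pos_unique ep) eqxx.
  apply/orP; right; apply/nonrecP; rewrite val_mul_simple //; split=> //.
    by repeat (case: eqP); lia.
  have [eq|neq] := eqVneq (w q : nat) c.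
    have qe := congr1 val (pos_unique eq); rewrite /= in qe.
    have hl' : (pos w c.+1 < pos w c)%N := hl.
    exists (pos w c.+1); rewrite !val_mul_simple // e2 //.
    by split; try lia; repeat (case: eqP); lia.
  exists q; rewrite !val_mul_simple //.
  by split; try lia; repeat (case: eqP); lia.
move: h2 h5 h6; rewrite !val_mul_simple // => h2 h5 h6.
apply/nonrecP; split=> //; first by move: h2 h5 h6; repeat (case: eqP); lia.
exists q; split=> //; first by move: h2 h5 h6; repeat (case: eqP); lia.
by move: h2 h5 h6; repeat (case: eqP); lia.
Qed.

Lemma pos_notin_swap i c w : (c < m)%N ->
  pos w c \notin nonrec i c (w * simple m c)%g.
Proof.
move=> hc; apply/negP => /nonrecP [_ h _]; move: h.
by rewrite val_mul_simple // val_pos; [rewrite eqxx|]; lia.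
Qed.

(** The exchange destroys the inversion formed by [c.+1] and [c] and creates none. *)
Lemma nonrec_swap_sub k c w : (c < m)%N -> ldes w c ->
  nonrec k m (w * simple m c)%g \subset nonrec k m w.
Proof.
move=> hc hl; rewrite /ldes in hl.
apply/subsetP => p /nonrecP [h1 _ [q [h3 h4 h5 _]]].
apply/nonrecP; split=> //; first by have := ltn_ord (w p); lia.
exists q; split=> //; last by have := ltn_ord (w q); lia.
move: h5; rewrite !val_mul_simple //.
case: (eqVneq (w p : nat) c.+1) => [ep|].
  have pe := congr1 val (pos_unique ep); rewrite /= in pe.
  case: (eqVneq (w q : nat) c) => [eq|].
    by have := congr1 val (pos_unique eq) => /=; lia.
  by repeat (case: eqP); lia.
by repeat (case: eqP); lia.
Qed.

End NonRecords.

(** * Alternating signs and the upper bound on exponents *)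

Section Support.
Variable m : nat.
Notation P := {mpoly int[m.+1]}.
Notation V := {ffun 'S_m.+1 -> P^o}.
Implicit Types (w : 'S_m.+1) (c d i : nat) (k : 'I_m.+1) (f g : V).
Implicit Types (a b : 'X_{1..m.+1}).

Definition scoef f w a : int := (-1) ^+ (mdeg a + odd_perm w) * (f w : P)@_a.

Definition alternating f := forall w a, 0 <= scoef f w a.

Lemma scoef_eq0 f w a : (scoef f w a == 0) = (a \notin msupp (f w : P)).
Proof. by rewrite /scoef mulf_eq0 signr_eq0 /= mcoeff_eq0. Qed.

Lemma mcoeffMXU (p : P) k a :
  (p * 'X_k)@_a = if a k == 0%N then 0 else p@_(a - U_(k))%MM.
Proof.
case: eqP => [e|/eqP ne].
  apply/eqP; rewrite mcoeff_eq0 (perm_mem (msuppMX _ _)); apply/negP.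
  by case/mapP => b _ eb; move: e; rewrite eb mnmDE mnm1E eqxx.
have le : (U_(k) <= a)%MM.
  apply/mnm_lepP => l; rewrite mnm1E; case: eqP => // <-; lia.
by rewrite -[in LHS](submK le) addmC mcoeffMX.
Qed.

Lemma odd_mul_simple w c : (c < m)%N ->
  odd_perm (w * simple m c)%g = ~~ odd_perm w.
Proof.
move=> hc; rewrite odd_permM /simple odd_tperm eq_inord //; last by lia.
by rewrite (_ : (c == c.+1) = false) ?addbT //; lia.
Qed.

(** The swapped term lowers both degree and length by one, so its sign is kept; the other lowers
    only the degree, which absorbs the minus sign in [U]. *)
Lemma scoef_H c k f w a : (c < m)%N ->
  scoef (H c 'X_k f) w a = scoef f w a +
    if ldes w c && (a k != 0%N) then
      scoef f (w * simple m c)%g (a - U_(k))%MM + scoef f w (a - U_(k))%MM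
    else 0.
Proof.
move=> hc; rewrite /scoef /H addE scaleE UE mcoeffD.
case: (ldes w c) => /=; last by rewrite mulr0 mcoeff0 !addr0.
rewrite (mulrC 'X_k) mcoeffMXU; case: eqP => [_|/eqP ne] /=; first by rewrite !addr0.
rewrite mcoeffB odd_mul_simple //.
have -> : mdeg a = (mdeg (a - U_(k))%MM).+1.
  rewrite -[in LHS](@submK _ U_(k)%MM a) ?mdegD ?mdeg1 ?addn1 //.
  by apply/mnm_lepP => l; rewrite mnm1E; case: eqP => // <-; lia.
by case: (odd_perm w); rewrite /= ?addn0 ?addn1 ?exprS; ring.
Qed.

Lemma alternating_H c k f : (c < m)%N ->
  alternating f -> alternating (H c 'X_k f).
Proof.
move=> hc h w a; rewrite scoef_H // addr_ge0 //.
by case: ifP => _ //; rewrite addr_ge0.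
Qed.

(** A sum of nonnegative signed coefficients vanishes only termwise, so supports unite without
    cancellation. *)
Lemma msupp_H c k f w a : (c < m)%N -> alternating f ->
  (a \in msupp (H c 'X_k f w : P)) = (a \in msupp (f w : P)) ||
   [&& ldes w c, a k != 0%N &
     ((a - U_(k))%MM \in msupp (f (w * simple m c)%g : P)) ||
     ((a - U_(k))%MM \in msupp (f w : P))].
Proof.
move=> hc h; rewrite -[LHS]negbK -scoef_eq0 scoef_H //.
rewrite paddr_eq0 ?h //; last by case: ifP => // _; rewrite addr_ge0 ?h.
rewrite scoef_eq0 andbA; case: ifP => _; last by rewrite eqxx andbT negbK orbF.
by rewrite paddr_eq0 ?h // !scoef_eq0 -!negb_or negbK.
Qed.

Lemma alternating_delta : alternating (delta m P).
Proof.
move=> w a; rewrite /scoef ffunE; case: eqP => [->|_]; last by rewrite mcoeff0 mulr0.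
rewrite mcoeff1 odd_perm1 addn0; case: eqP => [->|_]; last by rewrite mulr0.
by rewrite mdeg0.
Qed.

Lemma alternating_sweep i k f : alternating f -> forall c, (i <= c <= m)%N ->
  alternating (sweep i c 'X_k f).
Proof.
move=> h; apply: (@sweep_ind _ _ (fun _ g => alternating g)) => // c g hc.
by apply: alternating_H; lia.
Qed.

Lemma alternating_Gr i : (i <= m)%N -> alternating (Gr m i).
Proof.
move: {2}(m - i)%N (erefl (m - i)%N) => d; elim: d i => [|d IH] i hd hi.
  by have -> : i = m; [lia|rewrite Gr_top; exact: alternating_delta].
by rewrite Gr_step ?A_sweep; [apply: alternating_sweep; [apply: IH|]|]; lia.
Qed.

Lemma msupp_Gr_bound i w a : (i <= m)%N -> a \in msupp (Gr m i w : P) ->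
  forall k, (if k < i then a k == 0 else a k <= #|nonrec k m w|)%N.
Proof.
move: {2}(m - i)%N (erefl (m - i)%N) => d; elim: d i w a => [|d IH] i w a hd hi.
  have -> : i = m by lia.
  rewrite Gr_top ffunE; case: eqP => _; last by rewrite msupp0.
  by rewrite msupp1 inE => /eqP -> k; rewrite mnm0E; case: ifP.
have him : (i < m)%N by lia.
have hi0 : (inord i : 'I_m.+1) = i :> nat by rewrite inordK //; lia.
rewrite Gr_step // A_sweep => ha.
(* Invariant of row [i] before the letter [c]: the exponent of variable [i] sees only values up to
   [c], the others already have their final bounds. *)
pose Q c (g : V) := alternating g /\ forall w a, a \in msupp (g w : P) ->
  [/\ fixes w i, (a (inord i) <= #|nonrec i c w|)%N &
    forall k, k != inord i ->
      (if k < i then a k == 0 else a k <= #|nonrec k m w|)%N].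
have : Q m (sweep i m (X m i) (Gr m i.+1)).
  apply: (@sweep_ind _ _ Q); last by lia.
    split=> [|v b hb]; first by apply: alternating_Gr; lia.
    have hv : fixes v i.+1.
      apply: Gr_fixes => //; apply/eqP => e.
      by move: hb; rewrite e msupp0.
    have hd' : (m - i.+1 = d)%N by lia.
    have h := IH i.+1 v b hd' him hb; split.
    - by apply: fixes_leq hv; lia.
    - by have := h (inord i); rewrite hi0 ltnSn => /eqP ->.
    - move=> k nk; have := h k.
      have : k != i :> nat.
        by apply: contra nk => /eqP e; apply/eqP/val_inj; rewrite /= hi0.
      by move=> ne; rewrite (_ : (k < i.+1)%N = (k < i)%N) //; lia.
  move=> c g hc [hg h]; split=> [|v b]; first by apply: alternating_H => //; lia.
  rewrite msupp_H //; last by lia.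
  have hcm : (c < m)%N by lia.
  case/orP => [/h [h1 h2 h3]|/and3P [hl nb]].
    by split=> //; apply: leq_trans h2 _; apply/subset_leq_card/nonrec_sub.
  have le : (U_(inord i) <= b)%MM.
    apply/mnm_lepP => l; rewrite mnm1E; case: eqP => // <-; lia.
  have ei : b (inord i) = ((b - U_(inord i))%MM (inord i)).+1.
    by rewrite -{1}(submK le) mnmDE mnm1E eqxx addn1.
  have ek k : k != inord i -> b k = (b - U_(inord i))%MM k.
    by move=> nk; rewrite -{1}(submK le) mnmDE mnm1E eq_sym (negPf nk) addn0.
  case/orP => /h [h1 h2 h3].
    have h1' : fixes v i by apply: (@fixes_mul_simple _ v c).
    split=> //.
      by rewrite nonrec_swap // cardsU1 pos_notin_swap // add1n ei ltnS.
    move=> k nk; have := h3 k nk; rewrite ek //; case: ifP => // _ hk.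
    by apply: leq_trans hk _; apply/subset_leq_card/nonrec_swap_sub.
  split=> //; last by move=> k nk; have := h3 k nk; rewrite ek.
  rewrite ei (cardsD1 (pos v c)) pos_in_nonrec // add1n ltnS.
  apply: leq_trans h2 _; apply/subset_leq_card; rewrite subsetD1 nonrec_sub /=.
  by apply: pos_notin_nonrec; lia.
case=> _ /(_ w a ha) [_ h2 h3] k.
have [->|nk] := eqVneq k (inord i); last exact: h3.
by rewrite hi0 ltnn.
Qed.

End Support.

(** * Attaining the bound for fireworks permutations *)

Section Fireworks.
Variable m : nat.
Notation P := {mpoly int[m.+1]}.
Implicit Types (w : 'S_m.+1) (c d i : nat) (p q r k : 'I_m.+1).

(* From position [i] on, each ascent of [w] ends at a left-to-right maximum. *)
Definition record_runs i w := forall r p q, (i <= r)%N -> p = r.+1 :> nat ->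
  (w r < w p)%N -> (i <= q)%N -> (q < p)%N -> (w q < w p)%N.

Lemma record_runs_leq i j w : (i <= j)%N -> record_runs i w -> record_runs j w.
Proof. by move=> hij h r p q hr e hw hq; apply: (h r) => //; lia. Qed.

(** The head of the decreasing run through [q] is at least [w q] and starts before [p], and [p] is
    itself a run start. *)
Lemma fireworks_record_runs w : fireworks w -> record_runs 0 w.
Proof.
move=> h r p q _ e hw _ hq.
have run_head : forall d q, q = d :> nat ->
    exists s : 'I_m.+1, [/\ (s <= q)%N, run_start w s & (w q <= w s)%N].
  elim=> [|d IH] x hx; first by exists x; rewrite /run_start /= hx eqxx.
  have hxm := ltn_ord x.
  pose y : 'I_m.+1 := insubd x x.-1.
  have ey : y = d :> nat by rewrite /y val_insubd hx /= (_ : (d < m.+1)%N) //; lia.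
  have [hlt|hge] := ltnP (w y) (w x).
    by exists x; rewrite /run_start -/y hlt orbT.
  have [s [h1 h2 h3]] := IH y ey; exists s; split=> //; first by lia.
  exact: leq_trans hge h3.
have [s [h1 h2 h3]] := run_head q q erefl.
apply: leq_ltn_trans h3 _; apply: h => //; last by lia.
rewrite /run_start; apply/orP; right.
rewrite (_ : insubd p p.-1 = r) //; apply/val_inj => /=.
have hp := ltn_ord p.
by rewrite val_insubd e /= (_ : (r < m.+1)%N) //; lia.
Qed.

(** Only the pair [c.+1], [c] changes its relative order, in favour of the later entry. It forms no
    new ascent in the range: its entries are not adjacent, or one of them sits at position [i]. *)
Lemma record_runs_swap i c w : (i <= c < m)%N -> fixes w i -> ldes w c ->
  pos w c.+1 = i :> nat \/ pos w c <> (pos w c.+1).+1 :> nat ->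
  record_runs i.+1 w -> record_runs i.+1 (w * simple m c)%g.
Proof.
move=> hc hw hl hadj h r p q hr ep hrp hq hqp.
have hcm : (c < m)%N by lia.
have hl' : (pos w c.+1 < pos w c)%N := hl.
have inj x : w x = c :> nat -> x = pos w c :> nat by move=> /pos_unique ->.
have inj' x : w x = c.+1 :> nat -> x = pos w c.+1 :> nat by move=> /pos_unique ->.
have i1 := inj r; have i2 := inj p; have i3 := inj q.
have i4 := inj' r; have i5 := inj' p; have i6 := inj' q.
have hrp' : (w r < w p)%N.
  by move: hrp; rewrite !val_mul_simple //; repeat (case: eqP); lia.
have hqp' := h r p q hr ep hrp' hq hqp.
by rewrite !val_mul_simple //; repeat (case: eqP); lia.
Qed.

Lemma nonrec_swap_eq i c w k : (i <= c < m)%N -> fixes w i -> ldes w c ->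
  pos w c.+1 = i :> nat \/ pos w c <> (pos w c.+1).+1 :> nat ->
  record_runs i.+1 w -> (i < k)%N ->
  nonrec k m (w * simple m c)%g = nonrec k m w.
Proof.
move=> hc hw hl hadj hr hk; have hcm : (c < m)%N by lia.
apply/eqP; rewrite eqEsubset nonrec_swap_sub //=.
have hl' : (pos w c.+1 < pos w c)%N := hl.
have inj x : w x = c :> nat -> x = pos w c :> nat by move=> /pos_unique ->.
have inj' x : w x = c.+1 :> nat -> x = pos w c.+1 :> nat by move=> /pos_unique ->.
apply/subsetP => p /nonrecP [h1 _ [q [h3 h4 h5 _]]].
have i2 := inj p; have i3 := inj q; have i5 := inj' p; have i6 := inj' q.
have e1 : w (pos w c) = c :> nat by apply: val_pos; lia.
have e2 : w (pos w c.+1) = c.+1 :> nat by apply: val_pos; lia.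
have bound (x : 'I_m.+1) : (x <= m)%N by have := ltn_ord x; lia.
apply/nonrecP; split=> //.
have [/andP [/eqP ep /eqP eq]|ne] :=
  boolP ((w p == c :> nat) && (w q == c.+1 :> nat)).
  have f2 := @fixes_pos _ w i c.+1 hw.
  have hb := ltn_ord (pos w c).
  (* The lost witness [c.+1] for [c] is replaced by the entry just before [c]. Were it smaller, [c]
     would end an ascent and be a record, against the earlier [c.+1]; nonadjacency excludes [c.+1]
     itself. *)
  have [r er] : exists r, r = (pos w c).-1 :> nat.
    by exists (inord (pos w c).-1); rewrite inordK //; lia.
  have hp := i2 ep; have hq := i6 eq.
  have hrv : (c.+1 < w r)%N.
    have i7 := inj' r; have i8 := inj r.
    have := hr r (pos w c) (pos w c.+1); rewrite e1 e2.
    by lia.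
  exists r; rewrite !val_mul_simple //; split; try lia.
    by repeat (case: eqP); lia.
  by rewrite -val_mul_simple.
exists q; split=> //; rewrite !val_mul_simple //.
by move: ne; repeat (case: eqP => /=); lia.
Qed.

(** The extremal exponent allowed by the invariant of [msupp_Gr_bound]; at [i = 0], [c = m] it is
    the vector [N(w)]. *)
Definition sweep_exp i c w : 'X_{1..m.+1} :=
  [multinom (if k < i then 0 else if k == i :> nat then #|nonrec i c w|
     else #|nonrec k m w|)%N | k < m.+1].

Lemma sweep_exp_swap i c w w' : (i <= m)%N ->
  #|nonrec i c.+1 w| = #|nonrec i c w'|.+1 ->
  (forall k, (i < k)%N -> nonrec k m w' = nonrec k m w) ->
  (sweep_exp i c.+1 w (inord i) != 0)%N /\
  (sweep_exp i c.+1 w - U_(inord i) = sweep_exp i c w')%MM.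
Proof.
move=> hi e h; have hi0 : (inord i : 'I_m.+1) = i :> nat by rewrite inordK //; lia.
split; first by rewrite mnmE hi0 ltnn eqxx e.
apply/mnmP => k; rewrite mnmBE mnm1E !mnmE -val_eqE /= hi0.
by case: ltngtP => hk; rewrite /= ?subn0 ?h // e subn1.
Qed.

(* Undoing the letter [c] on the way from [w] to the previous row: skip it when
   [c] precedes [c+1]; otherwise multiply by [x_i], keeping the permutation when
   [c+1] immediately precedes [c] past position [i] (a swap would destroy a
   descent), and swapping [c] with [c+1] in all other cases. *)
Lemma Gr_fireworks i w : (i <= m)%N -> fixes w i -> record_runs i w ->
  sweep_exp i m w \in msupp (Gr m i w : P).
Proof.
move: {2}(m - i)%N (erefl (m - i)%N) => d.
elim: d i w => [|d IH] i w hd hi hw hr.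
  have ei : i = m by lia.
  rewrite ei Gr_top ffunE (_ : w = 1%g) ?eqxx.
    rewrite msupp1 inE; apply/eqP/mnmP => k; rewrite mnmE mnm0E.
    case: ltnP => // hk; rewrite ifT; last by have := ltn_ord k; lia.
    apply/eqP; rewrite cards_eq0 -subset0; apply/subsetP => p.
    by move=> /nonrecP [_ _ [q [h1 h2 _ _]]]; have := ltn_ord p; lia.
  apply/permP => p; rewrite perm1; have [hp|hp] := ltnP p i; first exact: hw.
  have := fixes_val hw hp; have := ltn_ord p; have := ltn_ord (w p) => *.
  by apply/val_inj => /=; lia.
have him : (i < m)%N by lia.
have hi0 : (inord i : 'I_m.+1) = i :> nat by rewrite inordK //; lia.
rewrite Gr_step // A_sweep.
have main c v : (i <= c <= m)%N -> fixes v i -> record_runs i.+1 v ->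
    (v (inord i) <= c)%N ->
    sweep_exp i c v \in msupp (sweep i c (X m i) (Gr m i.+1) v : P).
  move=> hc; move: {2}(c - i)%N (erefl (c - i)%N) => l.
  elim: l c v hc => [|l IHl] c v hc hl hv hrv hvi.
    have ec : c = i by lia.
    rewrite ec sweep_nil.
    have hv' : fixes v i.+1.
      move=> p hp; have [hp'|hp'] := ltnP p i; first exact: hv.
      have -> : p = inord i by apply/val_inj; rewrite /= hi0; lia.
      have := fixes_val hv (p := inord i); rewrite hi0 => h.
      by apply/val_inj => /=; rewrite hi0; lia.
    (* From position [i] on all values are at least [i], so no nonrecord has a value up to [i] and
       the exponent of variable [i] is 0. *)
    rewrite (_ : sweep_exp i i v = sweep_exp i.+1 m v); first by apply: IH => //; lia.
    apply/mnmP => k; rewrite !mnmE.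
    have -> : (k < i.+1)%N = (k < i)%N || (k == i :> nat) by lia.
    case: (ltngtP (k : nat) i) => hk //=; last first.
      apply/eqP; rewrite cards_eq0 -subset0; apply/subsetP => p.
      move=> /nonrecP [h1 h2 [q [h3 h4 h5 h6]]].
      by have := fixes_val hv h1; lia.
    by case: eqP => // ->.
  case: c hc hl hvi => [|c] hc hl hvi; first by lia.
  have hcm : (c < m)%N by lia.
  have hic : (i <= c < m)%N by lia.
  rewrite sweep_step; last by lia.
  have alt : alternating (sweep i c (X m i) (Gr m i.+1)).
    by apply: alternating_sweep; [apply: alternating_Gr|]; lia.
  rewrite msupp_H //; have [hl'|hskip] := boolP (ldes v c); last first.
    rewrite (_ : sweep_exp i c.+1 v = sweep_exp i c v).
      rewrite IHl //; try lia.
      (* The value [c.+1] at position [i] would put [c.+1] before [c], contrary to [hskip]. *)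
      move: hvi; rewrite leq_eqVlt => /orP [/eqP e|]; last by lia.
      have := fixes_pos hv (c := c); have := @pos_inj _ v c c.+1; move: hskip.
      have ep : pos v c.+1 = inord i by rewrite -e pos_val.
      by rewrite /ldes ep hi0; lia.
    by apply/mnmP => k; rewrite !mnmE nonrec_skip.
  have lt_pos : (pos v c.+1 < pos v c)%N := hl'.
  have [hadj|/norP [ni /negPn /eqP hadj]] := boolP
      ((pos v c.+1 == i :> nat) || (pos v c != (pos v c.+1).+1 :> nat)).
    have {}hadj : pos v c.+1 = i :> nat \/ pos v c <> (pos v c.+1).+1 :> nat.
      by case/orP: hadj => /eqP; [left|right].
    have [||n1 e1] := @sweep_exp_swap i c v (v * simple m c)%g hi.
    - by rewrite nonrec_swap // cardsU1 pos_notin_swap // add1n.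
    - by move=> k hk; apply: (nonrec_swap_eq hic).
    rewrite n1 e1 IHl ?orbT //; try lia.
    - move=> p hp; apply/val_inj => /=; rewrite val_mul_simple // hv //.
      by repeat (case: eqP); lia.
    - exact: record_runs_swap hic _ _ _ _.
    - rewrite val_mul_simple //.
      have : v (inord i) = c :> nat -> pos v c = i :> nat.
        by move=> /pos_unique <-.
      have := fixes_pos hv (c := c.+1).
      by repeat (case: eqP); lia.
  have [|//|n1 e1] := @sweep_exp_swap i c v v hi.
    by rewrite nonrec_adjacent // cardsU1 pos_notin_nonrec ?add1n // ltnW.
  rewrite n1 e1 IHl ?orbT //; try lia.
  have : v (inord i) = c.+1 :> nat -> pos v c.+1 = i :> nat.
    by move=> /pos_unique <-.
  by lia.
apply: main => //; first by lia.
  by apply: record_runs_leq hr; lia.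
by have := ltn_ord (w (inord i)); lia.
Qed.

Lemma groth_fireworks w : fireworks w ->
  [multinom #|nonrec k m w| | k < m.+1] \in msupp (groth w).
Proof.
move=> /fireworks_record_runs h; rewrite grothE.
rewrite (_ : [multinom _ | _ < _] = sweep_exp 0 m w).
  exact: Gr_fireworks.
by apply/mnmP => k; rewrite !mnmE; case: eqP => // ->.
Qed.

Lemma groth_bound w a : a \in msupp (groth w) ->
  (a <= [multinom #|nonrec k m w| | k < m.+1])%MM.
Proof.
rewrite grothE => ha; apply/mnm_lepP => k; rewrite mnmE.
by have := msupp_Gr_bound (leq0n m) ha k.
Qed.

End Fireworks.

Theorem theorem3p15 (n : nat) (w : 'S_n) (alpha : 'X_{1..n}) :
  fireworks w ->
  alpha \in msupp (groth w) ->
  (mdeg alpha < pdeg (groth w))%N ->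
  exists2 beta : 'X_{1..n}, beta \in msupp (groth w) & mlt alpha beta.
Proof.
case: n w alpha => [|m] w alpha hw ha hd.
  move: hd; rewrite /pdeg big1 // => b _.
  by rewrite mdegE big_ord0.
exists [multinom #|nonrec k m w| | k < m.+1]; first exact: groth_fireworks.
(* All exponents lie below this vector, so it has the largest degree and cannot equal [alpha]. *)
rewrite /mlt groth_bound //=; apply: contraTneq hd => ->.
rewrite -leqNgt /pdeg; apply/bigmax_leqP_seq => b hb _.
rewrite !mdegE; apply: leq_sum => k _.
exact: (mnm_lepP (groth_bound hb)).
Qed.
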